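(* Let $n$ be a positive integer, let $w_1,w_2,\dots,w_n$ be positive integers, let $m\ge 0$ be an integer and let $x\in\mathbb{Z}_p$. For a permutation $\sigma$ in the symmetric group $S_n$ of degree $n$, put $W_\sigma=w_{\sigma(1)}w_{\sigma(2)}\cdots w_{\sigma(n-1)}$. Then the expression $$[W_\sigma]_q^{\,m-1}\sum_{k_1=0}^{w_{\sigma(1)}-1}\cdots\sum_{k_{n-1}=0}^{w_{\sigma(n-1)}-1} q^{\,w_{\sigma(n)}\sum_{j=1}^{n-1}\left(\prod_{1\le i\le n-1,\, i\ne j}w_{\sigma(i)}\right)k_j}\;\beta_{m,\,\frac{\lambda}{[W_\sigma]_q},\,q^{W_\sigma}}\!\left(w_{\sigma(n)}x+\frac{w_{\sigma(n)}}{w_{\sigma(1)}}k_1+\cdots+\frac{w_{\sigma(n)}}{w_{\sigma(n-1)}}k_{n-1}\right)$$ takes the same value for every permutation $\sigma\in S_n$.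
   Context: Let $p$ be a fixed odd prime, $\mathbb{Z}_p$ the ring of $p$-adic integers, and $\mathbb{C}_p$ the completion of the algebraic closure of $\mathbb{Q}_p$, with norm normalized by $|p|_p=1/p$. Let $q\in\mathbb{C}_p$, $q\ne1$, with $|1-q|_p<p^{-1/(p-1)}$, and let $\lambda\in\mathbb{C}_p$ with $\lambda\neq 0$, $|\lambda|_p\le 1$. For $Q\in\mathbb{C}_p$, $Q\ne 1$, $|1-Q|_p<p^{-1/(p-1)}$, write $Q^a=\exp(a\log Q)$ (whenever the exponential converges) and $[a]_Q=\frac{1-Q^a}{1-Q}$. In particular, for $Q=q^{W}$ with $W$ a positive integer and $a\in\mathbb{Q}_p$ with $Wa\in\mathbb{Z}_p$, one has $Q^a=q^{Wa}$. For $f:\mathbb{Z}_p\to\mathbb{C}_p$ uniformly differentiable, the $p$-adic $q$-integral with parameter $Q$ is $$\int_{\mathbb{Z}_p}f(y)\,d\mu_Q(y)=\lim_{N\to\infty}\frac{1}{[p^N]_Q}\sum_{y=0}^{p^N-1}f(y)Q^y .$$ For nonzero $\nu\in\mathbb{C}_p$, the (fully) degenerate $q$-Bernoulli polynomials $\beta_{m,\nu,Q}(a)$ are defined by the generating function $$\int_{\mathbb{Z}_p}(1+\nu t)^{\frac1\nu[a+y]_Q}\,d\mu_Q(y)=\sum_{m=0}^\infty\beta_{m,\nu,Q}(a)\frac{t^m}{m!},$$ understood as an identity of power series in $t$, with $(1+\nu t)^{z/\nu}=\sum_{m\ge0}\binom{z/\nu}{m}\nu^m t^m$ and the integral taken coefficientwise.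 Empty products equal $1$, empty sums in exponents and arguments equal $0$, and for $n=1$ the iterated sum over the $k_j$ has a single term. *)

(* Defs.v *)
From mathcomp Require Import all_boot all_order all_algebra all_fingroup.
From mathcomp Require Import all_classical all_reals all_analysis.
Set Implicit Arguments.
Unset Strict Implicit.
Unset Printing Implicit Defensive.

Import Order.TTheory GRing.Theory Num.Theory.
Import numFieldNormedType.Exports.

Local Open Scope classical_set_scope.
Local Open Scope ring_scope.

Section AbsoluteValue.
Variables (R : realType) (K : fieldType) (abs : K -> R).

Definition cvg_abs (u : nat -> K) (l : K) : Prop :=
  (fun n => abs (u n - l)) @ \oo --> (0 : R).

Definition cauchy_abs (u : nat -> K) : Prop :=
  forall e : R, 0 < e ->
    exists N : nat, forall i j : nat, (N <= i)%N -> (N <= j)%N ->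
      abs (u i - u j) < e.

(* When abs (p%:R) = 1/p this is the copy of Q_p inside K.                    *)
Definition closure_rat (x : K) : Prop :=
  exists u : nat -> rat, cvg_abs (fun n => ratr (u n)) x.

Definition algebraic_over_closure_rat (z : K) : Prop :=
  exists P : {poly K},
    [/\ P != 0, forall i, closure_rat P`_i & root P z].

End AbsoluteValue.

(* C_p, specified as the completion of an algebraic closure of Q_p.  Such a   *)
(* K is unique up to isometric isomorphism: Cp_absp forces the absolute value *)
(* to be the p-adic one on the rationals, whose closure is then Q_p by        *)
(* Cp_complete; by Cp_split the elements of K that are algebraic over Q_p     *)
(* form an algebraic closure of Q_p, and by Cp_dense the complete field K is  *)
(* its completion.                                                            *)
Record padicComplex (p : nat) (R : realType) := PadicComplex {
  Cp_sort :> fieldType;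
  Cp_abs : Cp_sort -> R;
  Cp_abs_ge0 : forall x, 0 <= Cp_abs x;
  Cp_abs_eq0 : forall x, Cp_abs x = 0 <-> x = 0;
  Cp_absM : forall x y, Cp_abs (x * y) = Cp_abs x * Cp_abs y;
  Cp_absD : forall x y, Cp_abs (x + y) <= Num.max (Cp_abs x) (Cp_abs y);
  Cp_absp : Cp_abs p%:R = p%:R^-1;
  Cp_complete : forall u, cauchy_abs Cp_abs u -> exists l, cvg_abs Cp_abs u l;
  Cp_split : forall P : {poly Cp_sort},
    (forall i, closure_rat Cp_abs P`_i) ->
    exists rs : seq Cp_sort,
      P = lead_coef P *: \prod_(z <- rs) ('X - z%:P);
  Cp_dense : forall (x : Cp_sort) (e : R), 0 < e ->
    exists2 z, algebraic_over_closure_rat Cp_abs z & Cp_abs (x - z) < e }.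

Section PadicAnalysis.
Variables (p : nat) (R : realType) (K : padicComplex p R).

Definition padic_num : set K := [set x | closure_rat (@Cp_abs p R K) x].

Definition padic_int : set K := [set x | padic_num x /\ Cp_abs x <= 1].

(* p^(-1/(p-1)), the radius of convergence of the p-adic exponential.         *)
Definition exp_radius : R := p%:R `^ (- (p%:R - 1)^-1).

(* The limit of u in K (0 if u diverges).                                     *)
Definition plim (u : nat -> K) : K :=
  xget 0 [set l | cvg_abs (@Cp_abs p R K) u l].

Definition pexp (z : K) : K :=
  plim (fun N => \sum_(0 <= k < N) z ^+ k / k`!%:R).

Definition plog (z : K) : K :=
  plim (fun N => \sum_(1 <= k < N) (-1) ^+ k.+1 * (z - 1) ^+ k / k%:R).

Definition ppow (Q a : K) : K := pexp (a * plog Q).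

Definition qnum (Q a : K) : K := (1 - ppow Q a) / (1 - Q).

(* The integral over Z_p of f against mu_Q; only the values of f at the       *)
(* natural numbers, which are dense in Z_p, enter the Riemann sums.           *)
Definition qintegral (Q : K) (f : K -> K) : K :=
  plim (fun N => (qnum Q (p ^ N)%:R)^-1 *
                 \sum_(0 <= y < p ^ N) f y%:R * Q ^+ y).

Definition gbinom (z : K) (m : nat) : K :=
  (\prod_(i < m) (z - i%:R)) / m`!%:R.

(* Coefficient of t^m in (1 + nu t)^(z / nu).                                 *)
Definition degen_pow_coef (nu z : K) (m : nat) : K :=
  gbinom (z / nu) m * nu ^+ m.

(* m! times the coefficient of t^m in the generating function, the integral   *)
(* of (1 + nu t)^([a + y]_Q / nu) taken coefficientwise.                      *)
Definition degen_qbernoulli (m : nat) (nu Q a : K) : K :=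
  m`!%:R * qintegral Q (fun y => degen_pow_coef nu (qnum Q (a + y)) m).

Section SymmetricExpression.
Variables (n : nat) (w : 'I_n.+1 -> nat) (s : 'S_n.+1).

(* Of the n.+1 weights, those at the first n positions after permuting by s,  *)
(* and the one at the last position.                                          *)
Definition winit (j : 'I_n) : nat := w (s (widen_ord (leqnSn n) j)).
Definition wlast : nat := w (s ord_max).
Definition Wprod : nat := \prod_(j < n) winit j.

(* The iterated sum is written as one sum over the box of tuples k.           *)
Definition symm_expr (m : nat) (q lam x : K) : K :=
  qnum q Wprod%:R ^ (m%:Z - 1) *
  \sum_(k : {dffun forall j : 'I_n, 'I_(winit j)})
    q ^+ (wlast * \sum_(j < n) (\prod_(i < n | i != j) winit i) * k j)%N *
    degen_qbernoulli m (lam / qnum q Wprod%:R) (q ^+ Wprod)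
      (wlast%:R * x + \sum_(j < n) wlast%:R / (winit j)%:R * (k j)%:R).

End SymmetricExpression.

End PadicAnalysis.

(* Main.v *)
(* Put P = w_1 ... w_n and let W be the product of all weights but the last in
   the order given by the permutation.  Up to the factor [W]_q^(-m), the
   integrand of beta_m at the parameter Q = q^W is a polynomial G in
   q^(W(a + y)), where G depends only on q, lam and m.  The Riemann sums of a
   power of Q^y are geometric, so the integral is explicit; the sums over the
   k_j are geometric as well.  The expression becomes
     (1-q) sum_i G_i q^(iPx) (i+1) (1 - q^((i+1)P))^(n-1)
                             / prod_j (1 - q^((i+1)P/w_j)),
   in which the order of the weights no longer appears.
   The p-adic input is that exp is additive and injective on the disc of radius
   r = p^(-1/(p-1)) and that exp (log q) = q there; both reduce to polynomial
   congruences together with Gauss norms at a radius at which the truncated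
   series are bounded, by r^(k-1) <= |k!|. *)
Require Import Defs.
From mathcomp Require Import all_boot all_order all_algebra all_fingroup.
From mathcomp Require Import all_classical all_reals all_analysis.
From mathcomp Require Import ring.
Import Order.TTheory GRing.Theory Num.Theory.
Local Open Scope ring_scope.

Set Implicit Arguments.
Unset Strict Implicit.
Unset Printing Implicit Defensive.

(* Legendre's formula, telescoped: (p-1) floor(k/p^j) <= floor(k/p^(j-1)) - floor(k/p^j),
   with floor(k/p^J) >= 1 at the last term. *)
Lemma leq_logn_fact (p k : nat) : prime p ->
  (p.-1 * logn p k`! <= k.-1)%N.
Proof.
move=> p_pr; case: k => [|k]; first by rewrite fact0 logn1 muln0.
have p_gt1 := prime_gt1 p_pr.
set J := trunc_log p k.+1.
have telescope d : (p.-1 * (\sum_(1 <= j < d.+1) k.+1 %/ p ^ j) +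
    k.+1 %/ p ^ d <= k.+1)%N.
  elim: d => [|d IH]; first by rewrite big_geq // muln0 expn0 divn1.
  apply: leq_trans IH; rewrite big_nat_recr //= mulnDr -addnA leq_add2l.
  rewrite -mulSnr prednK ?prime_gt0 // expnSr divnMA mulnC.
  exact: leq_trunc_div.
rewrite logn_fact // -ltnS /=.
have /andP[J_le J_gt] := trunc_log_bounds p_gt1 (ltn0Sn k).
rewrite -/J in J_le J_gt.
have leJk : (J <= k.+1)%N.
  by apply: leq_trans J_le; apply: ltnW; exact: ltn_expl.
rewrite (@big_cat_nat _ _ _ J.+1) //=.
have -> : (\sum_(J.+1 <= j < k.+2) k.+1 %/ p ^ j = 0)%N.
  rewrite big_nat big1 // => j /andP[ltJj _]; apply: divn_small.
  by apply: leq_trans J_gt _; rewrite leq_exp2l.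
rewrite addn0; apply: leq_trans (telescope J); rewrite -addn1 leq_add2l.
by rewrite divn_gt0 ?expn_gt0 ?prime_gt0.
Qed.

(** * Absolute values, and their values on integers *)

Section PadicAbs.
Variables (p : nat) (R : realType) (K : padicComplex p R).
Hypothesis p_pr : prime p.
Local Notation abs := (@Cp_abs p R K).
Local Notation r := (exp_radius p R).

Lemma abs_ge0 (x : K) : 0 <= abs x. Proof. exact: Cp_abs_ge0. Qed.
#[local] Hint Resolve abs_ge0 : core.

Lemma abs0 : abs 0 = 0. Proof. exact/Cp_abs_eq0. Qed.

Lemma abs_gt0 (x : K) : (0 < abs x) = (x != 0).
Proof.
rewrite lt_neqAle abs_ge0 andbT eq_sym; congr (~~ _).
by apply/eqP/eqP => /Cp_abs_eq0.
Qed.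

Lemma abs1 : abs 1 = 1.
Proof.
have n0 : abs 1 != 0 by rewrite gt_eqF // abs_gt0 oner_neq0.
by apply: (mulfI n0); rewrite -Cp_absM !mulr1.
Qed.

Lemma absN (x : K) : abs (- x) = abs x.
Proof.
rewrite -mulN1r Cp_absM; suff -> : abs (-1) = 1 by rewrite mul1r.
have /eqP: abs (-1) ^+ 2 = 1 by rewrite expr2 -Cp_absM mulrNN mulr1 abs1.
rewrite sqrf_eq1 => /orP[/eqP //|/eqP e].
by have := abs_ge0 (-1); rewrite e oppr_ge0 ler10.
Qed.

Lemma absX (x : K) n : abs (x ^+ n) = abs x ^+ n.
Proof. by elim: n => [|n IH]; rewrite ?abs1 // !exprS Cp_absM IH. Qed.

Lemma absV (x : K) : abs x^-1 = (abs x)^-1.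
Proof.
have [->|x0] := eqVneq x 0; first by rewrite invr0 abs0 invr0.
have a0 : abs x != 0 by rewrite gt_eqF // abs_gt0.
by apply: (mulfI a0); rewrite -Cp_absM !divff // abs1.
Qed.

Lemma absD_le (x y : K) c : abs x <= c -> abs y <= c -> abs (x + y) <= c.
Proof. by move=> hx hy; apply: le_trans (Cp_absD _ _) _; rewrite ge_max hx. Qed.

Lemma absB_le (x y : K) c : abs x <= c -> abs y <= c -> abs (x - y) <= c.
Proof. by move=> hx hy; apply: absD_le; rewrite ?absN. Qed.

Lemma absD_lt (x y : K) c : abs x < c -> abs y < c -> abs (x + y) < c.
Proof. by move=> hx hy; apply: le_lt_trans (Cp_absD _ _) _; rewrite gt_max hx. Qed.

Lemma abs_distC (x y : K) : abs (x - y) = abs (y - x).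
Proof. by rewrite -opprB absN. Qed.

Lemma abs_sum_le (I : Type) (s : seq I) (P : pred I) (F : I -> K) c :
  0 <= c -> (forall i, P i -> abs (F i) <= c) -> abs (\sum_(i <- s | P i) F i) <= c.
Proof.
move=> c0 H; elim/big_ind: _ => //; first by rewrite abs0.
by move=> x y; exact: absD_le.
Qed.

Lemma abs_nat_le1 n : abs n%:R <= 1.
Proof.
elim: n => [|n IH]; first by rewrite abs0.
by rewrite -natr1; apply: absD_le; rewrite ?abs1.
Qed.

(** Bezout writes 1 as u p - v n; if |n| < 1, both terms would have absolute value below 1, hence so
    would 1. *)
Lemma abs_nat_coprime n : coprime p n -> abs n%:R = 1.
Proof.
move=> cop; apply: le_anti; rewrite abs_nat_le1 leNgt; apply/negP => lt1.
have [u v uv _] := egcdnP n (prime_gt0 p_pr).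
move: cop uv; rewrite /coprime => /eqP -> uv.
have : abs 1 < 1.
  have -> : (1 : K) = u%:R * p%:R - v%:R * n%:R.
    by rewrite -!natrM uv natrD addrC addKr.
  apply: absD_lt; rewrite ?absN Cp_absM.
    apply: le_lt_trans (ler_piMl _ (abs_nat_le1 _)) _ => //.
    by rewrite Cp_absp invf_lt1 ?ltr0n ?ltr1n ?prime_gt1 ?prime_gt0.
  exact: le_lt_trans (ler_piMl _ (abs_nat_le1 _)) _.
by rewrite abs1 ltxx.
Qed.

Lemma abs_nat n : (0 < n)%N -> abs n%:R = p%:R^-1 ^+ logn p n.
Proof.
move=> n0; have [m cop {1}->] := pfactor_coprime p_pr n0.
by rewrite natrM Cp_absM abs_nat_coprime // natrX absX Cp_absp mul1r.
Qed.

(** * The radius r and the terms of exp and log *)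

Lemma exp_radius_gt0 : 0 < r.
Proof. by rewrite powR_gt0 // ltr0n prime_gt0. Qed.
#[local] Hint Resolve exp_radius_gt0 : core.

Lemma exp_radiusX : r ^+ p.-1 = p%:R^-1.
Proof.
have p1 : (0 < p.-1)%N by rewrite -ltnS prednK ?prime_gt1 ?prime_gt0.
have -> : r = p%:R `^ (- (p.-1%:R)^-1).
  by rewrite /exp_radius -subn1 natrB ?prime_gt0.
rewrite -powR_mulrn ?powR_ge0 // -powRrM mulNr mulVf ?pnatr_eq0 -?lt0n //.
by rewrite powR_inv1 // ler0n.
Qed.

Lemma exp_radius_lt1 : r < 1.
Proof.
rewrite ltNge; apply/negP => r1.
have := exprn_ege1 p.-1 r1; rewrite exp_radiusX leNgt invf_lt1 ?ltr0n ?prime_gt0 //.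
by rewrite ltr1n prime_gt1.
Qed.

Lemma exp_radius_le1 : r <= 1. Proof. exact/ltW/exp_radius_lt1. Qed.

(** Since r^(p-1) = 1/p, |k!| is r^((p-1) v) with v the p-adic valuation of k!, and Legendre gives
    (p-1) v <= k-1. *)
Lemma exp_radius_fact k : r ^+ k.-1 <= abs k`!%:R.
Proof.
rewrite abs_nat ?fact_gt0 // -exp_radiusX -exprM.
by apply: ler_wiXn2l; rewrite ?exp_radius_le1 ?ltW ?leq_logn_fact.
Qed.

Lemma exp_radius_nat k : (0 < k)%N -> r ^+ k.-1 <= abs k%:R.
Proof.
case: k => // k _; apply: le_trans (exp_radius_fact k.+1) _.
by rewrite factS natrM Cp_absM ler_piMr // abs_nat_le1.
Qed.

Lemma natr_neq0 k : (0 < k)%N -> k%:R != 0 :> K.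
Proof.
move=> /exp_radius_nat; rewrite -abs_gt0; apply: lt_le_trans.
by rewrite exprn_gt0.
Qed.

Lemma fact_neq0 k : k`!%:R != 0 :> K.
Proof. by rewrite natr_neq0 ?fact_gt0. Qed.

(** The extra factor r, due to the exponent k-1 instead of k in [exp_radius_fact], is what later
    yields |exp z - 1| <= |z| and injectivity. *)
Lemma abs_exp_term (z : K) k : (0 < k)%N ->
  abs (z ^+ k / k`!%:R) <= r * (abs z / r) ^+ k.
Proof.
case: k => // k _; rewrite Cp_absM absX absV expr_div_n (exprS r) invfM.
rewrite mulrCA (mulrA r) divff ?gt_eqF // mul1r.
rewrite ler_wpM2l ?exprn_ge0 // lef_pV2 ?posrE ?exprn_gt0 //.
  exact: exp_radius_fact k.+1.
by rewrite abs_gt0 fact_neq0.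
Qed.

Lemma abs_exp_term0 (z : K) k : abs (z ^+ k / k`!%:R) <= (abs z / r) ^+ k.
Proof.
case: k => [|k]; first by rewrite expr0 fact0 divr1 abs1.
apply: le_trans (abs_exp_term z (ltn0Sn k)) _.
by rewrite ler_piMl ?exp_radius_le1 // exprn_ge0 // divr_ge0 // ltW.
Qed.

Lemma abs_log_term (z : K) k : (0 < k)%N ->
  abs ((-1) ^+ k.+1 * z ^+ k / k%:R) <= r * (abs z / r) ^+ k.
Proof.
case: k => // k _; rewrite 2!Cp_absM !absX absN abs1 expr1n mul1r absV.
rewrite expr_div_n (exprS r) invfM mulrCA (mulrA r) divff ?gt_eqF // mul1r.
rewrite ler_wpM2l ?exprn_ge0 // lef_pV2 ?posrE ?exprn_gt0 //.
  exact: exp_radius_nat k.+1 _.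
by rewrite abs_gt0 natr_neq0.
Qed.

(** * Limits and geometric error bounds *)

Local Notation cvgK := (cvg_abs (@Cp_abs p R K)).

Lemma cvg_absP (u : nat -> K) l : cvgK u l <->
  forall e, 0 < e -> exists N, forall n, (N <= n)%N -> abs (u n - l) < e.
Proof.
split=> [/cvgrPdist_lt h e e0|h].
  have [N _ hN] := h _ e0; exists N => n /hN /=.
  by rewrite sub0r normrN ger0_norm.
apply/cvgrPdist_lt => e /h [N hN]; exists N => // n /= /hN.
by rewrite sub0r normrN ger0_norm.
Qed.

Lemma cvg_abs_unique (u : nat -> K) l l' : cvgK u l -> cvgK u l' -> l = l'.
Proof.
move=> /cvg_absP h /cvg_absP h'; apply/eqP; rewrite -subr_eq0.
apply/negPn/negP; rewrite -abs_gt0 => d0.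
have [N hN] := h _ d0; have [M hM] := h' _ d0.
suff : abs (l - l') < abs (l - l') by rewrite ltxx.
rewrite -{1}(subrK (u (maxn N M)) l) -addrA.
by apply: absD_lt; [rewrite (abs_distC l (u _)) hN ?leq_maxl|rewrite hM ?leq_maxr].
Qed.

Lemma plimE (u : nat -> K) l : cvgK u l -> plim u = l.
Proof.
by move=> ul; apply: xget_unique => // l' ul'; exact: cvg_abs_unique ul' ul.
Qed.

Lemma geometric_small (c x e : R) : 0 <= x < 1 -> 0 < e ->
  exists N, forall n, (N <= n)%N -> c * x ^+ n < e.
Proof.
case/andP=> x0 x1 e0; have /cvgrPdist_lt h : (geometric c x n @[n --> \oo] --> 0)%classic.
  by apply: cvg_geometric; rewrite ger0_norm.
have [N _ hN] := h _ e0; exists N => n /hN /=; rewrite sub0r normrN.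
exact: le_lt_trans (ler_norm _).
Qed.

Lemma cvg_abs_geometric (u : nat -> K) l n0 c x : 0 <= x < 1 ->
  (forall n, (n0 <= n)%N -> abs (u n - l) <= c * x ^+ n) -> cvgK u l.
Proof.
move=> x01 h; apply/cvg_absP => e /(geometric_small c x01)[N hN].
exists (maxn n0 N) => n; rewrite geq_max => /andP[/h hn /hN].
exact: le_lt_trans.
Qed.

(** Ultrametrically, the distance from [u n] to any later term is at most the largest step in
    between, and the steps decrease. Hence the error keeps the constant [c], without a factor
    1/(1-x). *)
Lemma series_approx (u : nat -> K) n0 c x : 0 <= c -> 0 <= x < 1 ->
  (forall n, (n0 <= n)%N -> abs (u n.+1 - u n) <= c * x ^+ n) ->
  forall n, (n0 <= n)%N -> abs (u n - plim u) <= c * x ^+ n.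
Proof.
move=> c0 /andP[x0 x1] h.
have hD n d : (n0 <= n)%N -> abs (u n - u (n + d)%N) <= c * x ^+ n.
  move=> hn; elim: d => [|d IH]; first by rewrite addn0 subrr abs0 mulr_ge0 ?exprn_ge0.
  rewrite -(subrK (u (n + d)%N) (u n)) -addrA; apply: absD_le => //.
  rewrite addnS abs_distC; apply: le_trans (h _ _) _.
    exact: leq_trans (leq_addr _ _).
  by rewrite ler_wpM2l // ler_wiXn2l ?leq_addr // ltW.
have cauchy : cauchy_abs abs u.
  move=> e /(geometric_small c (introT andP (conj x0 x1)))[N hN].
  exists (maxn n0 N) => i j; rewrite !geq_max => /andP[hi Ni] /andP[hj Nj].
  wlog ij : i j hi Ni hj Nj / (i <= j)%N.
    by move=> H; case/orP: (leq_total i j) => ?; [|rewrite abs_distC]; exact: H.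
  by rewrite -(subnKC ij); apply: le_lt_trans (hD _ _ hi) (hN _ Ni).
have [l ul] := Cp_complete cauchy; rewrite (plimE ul) => n hn.
rewrite leNgt; apply/negP => lt1.
have [M hM] := (cvg_absP _ _).1 ul _ (le_lt_trans (mulr_ge0 c0 (exprn_ge0 n x0)) lt1).
suff : abs (u n - l) < abs (u n - l) by rewrite ltxx.
rewrite -{1}(subrK (u (n + M)%N) (u n)) -addrA; apply: absD_lt.
  exact: le_lt_trans (hD _ _ hn) lt1.
by rewrite hM // leq_addl.
Qed.

(** * Truncation errors of exp and log *)

Lemma exp_ratio (z : K) : abs z < r -> 0 <= abs z / r < 1.
Proof. by move=> zr; rewrite divr_ge0 ?(ltW exp_radius_gt0) //= ltr_pdivrMr ?mul1r. Qed.

Lemma pexp_approx1 (z : K) N : abs z < r -> (0 < N)%N ->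
  abs (\sum_(0 <= k < N) z ^+ k / k`!%:R - pexp z) <= r * (abs z / r) ^+ N.
Proof.
move=> zr; apply: (@series_approx _ 1%N); rewrite ?exp_ratio ?ltW // => n n0.
by rewrite big_nat_recr //= addrAC subrr add0r abs_exp_term.
Qed.

Lemma pexp_approx (z : K) N : abs z < r ->
  abs (\sum_(0 <= k < N) z ^+ k / k`!%:R - pexp z) <= (abs z / r) ^+ N.
Proof.
move=> zr; rewrite -[leRHS]mul1r.
apply: (@series_approx _ 0%N); rewrite ?exp_ratio // => n _.
by rewrite big_nat_recr //= addrAC subrr add0r mul1r abs_exp_term0.
Qed.

Lemma plog_approx (z : K) N : abs (1 - z) < r -> (0 < N)%N ->
  abs (\sum_(1 <= k < N) (-1) ^+ k.+1 * (z - 1) ^+ k / k%:R - plog z)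
    <= r * (abs (1 - z) / r) ^+ N.
Proof.
rewrite abs_distC => zr.
apply: (@series_approx _ 1%N); rewrite ?exp_ratio ?ltW // => n n0.
by rewrite big_nat_recr //= addrAC subrr add0r abs_log_term.
Qed.

Lemma abs_plog_le (z : K) : abs (1 - z) < r -> abs (plog z) <= abs (1 - z).
Proof.
move=> zr; have := plog_approx zr (ltn0Sn 0).
by rewrite big_geq // sub0r absN expr1 mulrC divfK ?gt_eqF.
Qed.

Lemma abs_pexpB1 (z : K) : abs z < r -> abs (pexp z - 1) <= abs z.
Proof.
move=> zr; have := pexp_approx1 zr (ltn0Sn 0).
by rewrite big_nat1 expr0 divr1 abs_distC expr1 mulrC divfK ?gt_eqF.
Qed.

(** The truncation 1 + z has error at most |z|^2/r, so |z| <= |z| (|z|/r) with |z|/r < 1. *)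
Lemma pexp_eq1 (z : K) : abs z < r -> pexp z = 1 -> z = 0.
Proof.
move=> zr e1; have := pexp_approx1 zr (ltn0Sn 1).
rewrite big_nat_recr //= big_nat1 e1 expr0 divr1 expr1 divr1 addrAC subrr add0r.
rewrite expr2 mulrA (mulrC r) divfK ?gt_eqF // -[X in X <= _]mulr1.
have [//|z0] := eqVneq z 0.
by rewrite ler_pM2l ?abs_gt0 // leNgt; case/andP: (exp_ratio zr) => _ ->.
Qed.

Lemma abs_pexp_le1 (z : K) : abs z < r -> abs (pexp z) <= 1.
Proof.
move=> zr; rewrite -(subrK 1 (pexp z)); apply: absD_le; last by rewrite abs1.
exact: le_trans (abs_pexpB1 zr) (le_trans (ltW zr) exp_radius_le1).
Qed.

Lemma eq0_geometric (z : K) x : 0 <= x < 1 -> (forall N, abs z <= x ^+ N) -> z = 0.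
Proof.
move=> x01 h; apply/eqP/negPn/negP; rewrite -abs_gt0 => z0.
have [N /(_ N (leqnn N))] := geometric_small 1 x01 z0.
by rewrite mul1r ltNge h.
Qed.

(** * Gauss norms of polynomials at radius s *)

Definition gauss_le (s c : R) (P : {poly K}) := forall d, abs P`_d * s ^+ d <= c.

Lemma gauss_leP (s c : R) (P : {poly K}) : 0 < s ->
  gauss_le s c P <-> forall d, abs P`_d <= c / s ^+ d.
Proof. by move=> s0; split=> h d; move: (h d); rewrite ler_pdivlMr ?exprn_gt0. Qed.

Lemma gauss_le_sum (I : Type) (t : seq I) (Pr : pred I) (F : I -> {poly K}) s c :
  0 < s -> 0 <= c -> (forall i, Pr i -> gauss_le s c (F i)) ->
  gauss_le s c (\sum_(i <- t | Pr i) F i).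
Proof.
move=> s0 c0 h; apply/gauss_leP => // d; rewrite coef_sum.
apply: abs_sum_le => [|i /h /gauss_leP]; last exact.
by rewrite divr_ge0 ?exprn_ge0 // ltW.
Qed.

Lemma gauss_leB s c (P Q : {poly K}) : 0 < s ->
  gauss_le s c P -> gauss_le s c Q -> gauss_le s c (P - Q).
Proof.
move=> s0 /gauss_leP hP /gauss_leP hQ; apply/gauss_leP => // d.
by rewrite coefB; apply: absB_le; [exact: hP|exact: hQ].
Qed.

Lemma gauss_leM s c c' (P Q : {poly K}) : 0 < s ->
  gauss_le s c P -> gauss_le s c' Q -> gauss_le s (c * c') (P * Q).
Proof.
move=> s0 hP hQ; apply/gauss_leP => // d; rewrite coefM.
have c0 : 0 <= c by apply: le_trans (hP 0%N); rewrite mulr_ge0 ?exprn_ge0 // ltW.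
have c'0 : 0 <= c' by apply: le_trans (hQ 0%N); rewrite mulr_ge0 ?exprn_ge0 // ltW.
apply: abs_sum_le => [|[j /= jd] _].
  by rewrite divr_ge0 ?exprn_ge0 ?mulr_ge0 // ltW.
rewrite ler_pdivlMr ?exprn_gt0 // Cp_absM -[in s ^+ d](subnKC (jd : (j <= d)%N)) exprD.
by rewrite mulrACA ler_pM ?mulr_ge0 ?exprn_ge0 // ltW.
Qed.

Lemma gauss_leX s c (P : {poly K}) k : 0 < s ->
  gauss_le s c P -> gauss_le s (c ^+ k) (P ^+ k).
Proof.
move=> s0 hP; elim: k => [|k IH]; last by rewrite !exprS; exact: gauss_leM.
move=> [|d]; rewrite expr0 coefC /= ?abs1 ?mulr1 // abs0 mul0r ler01 //.
Qed.

Lemma gauss_leZ s c (P : {poly K}) a : 0 < s ->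
  gauss_le s c P -> gauss_le s (abs a * c) (a *: P).
Proof. by move=> s0 hP d; rewrite coefZ Cp_absM -mulrA ler_wpM2l. Qed.

(** The term of degree d is at most c (|x|/s)^d, and only d >= N contributes. Applied to a
    difference of polynomials congruent modulo X^N, this turns the congruence into an estimate that
    is small with N. *)
Lemma abs_horner_le s c (P : {poly K}) N x : 0 < s -> abs x <= s ->
  gauss_le s c P -> (forall d, (d < N)%N -> P`_d = 0) ->
  abs P.[x] <= c * (abs x / s) ^+ N.
Proof.
move=> s0 xs hP P0; rewrite horner_coef.
have c0 : 0 <= c by apply: le_trans (hP 0%N); rewrite mulr_ge0 ?exprn_ge0 // ltW.
have y0 : 0 <= abs x / s by rewrite divr_ge0 // ltW.
apply: abs_sum_le => [|[i /= _] _]; first by rewrite mulr_ge0 ?exprn_ge0.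
have [iN|Ni] := ltnP i N; first by rewrite P0 // mul0r abs0 mulr_ge0 ?exprn_ge0.
have -> : abs (P`_i * x ^+ i) = (abs P`_i * s ^+ i) * (abs x / s) ^+ i.
  by rewrite Cp_absM absX -mulrA -exprMn mulrCA divff ?gt_eqF // mulr1.
apply: ler_pM; rewrite ?mulr_ge0 ?exprn_ge0 // ?(ltW s0) //.
by apply: ler_wiXn2l; rewrite // ler_pdivrMr ?mul1r.
Qed.

(** * Additivity of exp *)

Lemma exp_term_add (a b : K) d :
  \sum_(j < d.+1) a ^+ j / j`!%:R * (b ^+ (d - j) / (d - j)`!%:R) =
  (a + b) ^+ d / d`!%:R.
Proof.
rewrite addrC exprDn mulr_suml; apply: eq_bigr => [[j /= jd] _].
rewrite -(bin_fact (jd : (j <= d)%N)) !natrM -mulr_natr.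
have C0 : ('C(d, j))%:R != 0 :> K by rewrite natr_neq0 // bin_gt0.
by field; rewrite C0 !fact_neq0.
Qed.

(** [E z N] truncates exp(zX). By the binomial theorem [E a N * E b N] and [E (a + b) N] agree below
    degree N. Both have Gauss norm at most 1 at the radius [x^-1] > 1, so their values at X = 1
    differ by at most x^N. *)
Lemma pexpD (a b : K) : abs a < r -> abs b < r -> pexp (a + b) = pexp a * pexp b.
Proof.
move=> ar br; have abr : abs (a + b) < r by exact: absD_lt.
(* The entry 1/2 keeps [x] positive, so that [x^-1] is a radius, even when [a] and [b] both
   vanish. *)
pose x := Num.max (2^-1) (Num.max (abs a / r) (abs b / r)).
have x1 : x < 1.
  rewrite /x !gt_max !ltr_pdivrMr // !mul1r ar br !andbT.
  by rewrite invf_lt1 ?ltr1n.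
have x0 : 0 < x by rewrite /x lt_max invr_gt0 ltr0n.
have ax : abs a / r <= x by rewrite /x !le_max lexx !orbT.
have bx : abs b / r <= x by rewrite /x !le_max lexx !orbT.
have abx : abs (a + b) / r <= x.
  by rewrite ler_pdivrMr //; apply: absD_le; rewrite -ler_pdivrMr.
have small z N : abs z / r <= x -> (abs z / r) ^+ N <= x ^+ N.
  by move=> zx; rewrite lerXn2r // ?nnegrE ?divr_ge0 // ltW.
pose E z N : {poly K} := \poly_(k < N) (z ^+ k / k`!%:R).
have Eh z N : (E z N).[1] = \sum_(0 <= k < N) z ^+ k / k`!%:R.
  rewrite horner_poly big_mkord; apply: eq_bigr => i _.
  by rewrite expr1n mulr1.
have EG z N : abs z / r <= x -> gauss_le x^-1 1 (E z N).
  move=> zx; apply/gauss_leP; rewrite ?invr_gt0 // => d.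
  rewrite exprVn invrK mul1r coef_poly; case: ifP => _.
    exact: le_trans (abs_exp_term0 _ _) (small _ _ zx).
  by rewrite abs0 exprn_ge0 // ltW.
apply/eqP; rewrite -subr_eq0; apply/eqP/(@eq0_geometric _ x); rewrite ?x1 ?ltW // => N.
have hE z : abs z < r -> abs z / r <= x -> abs ((E z N).[1] - pexp z) <= x ^+ N.
  by move=> zr zx; rewrite Eh; apply: le_trans (pexp_approx _ zr) (small _ _ zx).
have hD : abs ((E a N).[1] * (E b N).[1] - (E (a + b) N).[1]) <= x ^+ N.
  rewrite -hornerM -hornerN -hornerD.
  have := @abs_horner_le x^-1 1 (E a N * E b N - E (a + b) N) N 1.
  rewrite abs1 invrK !mul1r; apply; rewrite ?invr_gt0 ?invf_ge1 ?(ltW x1) //.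
    apply: gauss_leB; rewrite ?invr_gt0 //; last exact: EG.
    rewrite -[X in gauss_le _ X]mulr1.
    by apply: gauss_leM; rewrite ?invr_gt0 //; exact: EG.
  move=> d dN; rewrite coefB coefM coef_poly dN -exp_term_add; apply/eqP.
  rewrite subr_eq0; apply/eqP/eq_bigr => [[j /= jd] _].
  by rewrite !coef_poly (leq_trans jd dN) (leq_ltn_trans (leq_subr _ _) dN).
have Eb1 : abs (E b N).[1] <= 1.
  rewrite -(subrK (pexp b) (_.[_])); apply: absD_le; last exact: abs_pexp_le1.
  exact: le_trans (hE _ br bx) (exprn_ile1 _ (ltW x0) (ltW x1)).
have -> : pexp (a + b) - pexp a * pexp b =
    - ((E (a + b) N).[1] - pexp (a + b)) +
    (- ((E a N).[1] * (E b N).[1] - (E (a + b) N).[1]) +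
     (((E a N).[1] - pexp a) * (E b N).[1] + pexp a * ((E b N).[1] - pexp b))).
  ring.
apply: absD_le; first by rewrite absN hE.
apply: absD_le; first by rewrite absN.
apply: absD_le; rewrite Cp_absM.
  by apply: le_trans (ler_piMr _ Eb1) (hE _ ar ax).
by apply: le_trans (ler_piMl _ (abs_pexp_le1 ar)) (hE _ br bx).
Qed.

(** * exp (log q) = q, through truncations of exp and of log(1 + X) *)

Definition log_poly N : {poly K} :=
  \sum_(0 <= k < N) ((-1) ^+ k / k.+1%:R) *: 'X^(k.+1).

Definition explog_poly N : {poly K} :=
  \sum_(0 <= k < N.+1) (k`!%:R)^-1 *: log_poly N ^+ k.

Lemma deriv_log_poly N : (1 + 'X) * (log_poly N)^`() = 1 - (- 'X) ^+ N.
Proof.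
have -> : (log_poly N)^`() = \sum_(i < N) (- 'X) ^+ i.
  rewrite /log_poly raddf_sum big_mkord; apply: eq_bigr => i _.
  rewrite /= derivZ derivXn /= -scaler_nat scalerA divfK ?natr_neq0 //.
  by rewrite -(scaleN1r 'X) exprZn.
have := subrX1 (- 'X : {poly K}) N.
by move=> h; rewrite -[RHS]opprB h -mulNr opprB opprK.
Qed.

Lemma log_polyX N : exists L, log_poly N = 'X * L.
Proof.
exists (\sum_(0 <= k < N) ((-1) ^+ k / k.+1%:R) *: 'X^k).
by rewrite mulr_sumr; apply: eq_bigr => k _; rewrite -scalerAr -exprS.
Qed.

(* exp' = exp and (1 + X) log' = 1 combine to (1 + X) F' = F for F = exp o log,
   up to the truncation error. *)
Lemma explog_poly_ode N : exists H : {poly K},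
  (1 + 'X) * (explog_poly N)^`() = explog_poly N - 'X^N * H.
Proof.
have [L1 hL] := log_polyX N.
have -> : (explog_poly N)^`() =
    (explog_poly N - (N`!%:R)^-1 *: log_poly N ^+ N) * (log_poly N)^`().
  rewrite /explog_poly [in RHS]big_nat_recr //= addrK big_nat_recl //= derivD.
  rewrite derivZ expr0 derivC scaler0 add0r raddf_sum mulr_suml.
  apply: eq_bigr => k _ /=; rewrite derivZ deriv_exp /= -scaler_nat scalerA.
  rewrite -scalerAl (mulrC (_ ^+ k)) factS natrM invfM mulrAC mulVf ?natr_neq0 //.
  by rewrite mul1r.
(* Two errors, both divisible by X^N: the last term log^N/N! of exp, which differentiation does not
   reproduce, and the (-X)^N of [deriv_log_poly]. *)
exists ((N`!%:R)^-1 *: L1 ^+ N * (1 - (- 'X) ^+ N) + (-1)^+N * explog_poly N).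
rewrite mulrCA deriv_log_poly hL exprMn (exprNn 'X).
by rewrite -!mul_polyC; ring.
Qed.

(** For d < N the differential equation reads (d+1) F_(d+1) + d F_d = F_d. With F_0 = 1 this forces
    F_1 = 1, and every later coefficient is 0. *)
Lemma coef_explog_poly N d : (d <= N)%N -> (explog_poly N)`_d = (1 + 'X : {poly K})`_d.
Proof.
rewrite coefD coef1 coefX; elim: d => [|d IH] dN.
  rewrite -horner_coef0 /explog_poly big_nat_recl //= fact0 invr1 scale1r.
  rewrite hornerD expr0 hornerC horner_sum big1 ?addr0 // => k _.
  have [L ->] := log_polyX N.
  by rewrite hornerZ horner_exp hornerM hornerX mul0r exprS mul0r mulr0.
have [H] := explog_poly_ode N; move/(congr1 (fun P : {poly K} => P`_d)).
rewrite coefB coefXnM dN subr0 (IH (ltnW dN)) mulrDl mul1r coefD coefXM coef_deriv.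
have nz := @natr_neq0 d.+1 (ltn0Sn d).
case: d => [|d] in IH dN nz *.
  by rewrite !addr0 mulr1n => ->; rewrite add0r.
rewrite coef_deriv (IH (ltnW dN)) /= => h.
apply: (mulIf nz); rewrite mulr_natr.
case: d => [|d] in h IH dN nz *; move: h; rewrite /= ?add0r ?addr0 ?mul0rn ?addr0.
  by rewrite mulr1n mul0r => /(canRL (addrK _)) ->; rewrite subrr.
by rewrite mul0r.
Qed.

Lemma gauss_log_poly N : gauss_le r r (log_poly N).
Proof.
apply: gauss_le_sum => // [|k _]; first exact: ltW.
move=> d; rewrite coefZ coefXn; have [->|_] := eqVneq d k.+1; last first.
  by rewrite mulr0 abs0 mul0r ltW.
rewrite mulr1 Cp_absM absX absN abs1 expr1n mul1r absV exprS mulrCA.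
rewrite ler_piMr ?(ltW exp_radius_gt0) // mulrC ler_pdivrMr ?abs_gt0 ?natr_neq0 // mul1r.
exact: (exp_radius_nat (ltn0Sn k)).
Qed.

Lemma gauss_explog_poly N : gauss_le r 1 (explog_poly N).
Proof.
apply: gauss_le_sum => // k _ d.
have [->|k0] := posnP k.
  rewrite fact0 invr1 scale1r expr0 coef1; case: d => [|d]; first by rewrite abs1 mulr1.
  by rewrite abs0 mul0r.
apply: le_trans (gauss_leZ _ _ (gauss_leX k _ (gauss_log_poly N)) d) _ => //.
rewrite absV mulrC ler_pdivrMr ?abs_gt0 ?fact_neq0 // mul1r.
apply: le_trans (exp_radius_fact k).
by apply: ler_wiXn2l; rewrite ?exp_radius_le1 ?leq_pred // ltW.
Qed.

(** With u = q - 1 and [l] the truncated logarithm, exp(log q) is compared with exp l, then with the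
    truncated exp at [l], which is [explog_poly] at u, and finally with 1 + u. Each distance is at
    most (|u|/r)^N. *)
Lemma pexp_plog (q : K) : abs (1 - q) < r -> pexp (plog q) = q.
Proof.
move=> qr; have := qr; rewrite abs_distC => ur.
set u := q - 1 in ur.
have x01 := exp_ratio ur; have /andP[x0 x1] := x01.
apply/eqP; rewrite -subr_eq0; apply/eqP/(eq0_geometric x01) => N.
have hl : (log_poly N).[u] =
    \sum_(1 <= k < N.+1) (-1) ^+ k.+1 * (q - 1) ^+ k / k%:R.
  rewrite horner_sum big_add1 /=; apply: eq_bigr => k _.
  by rewrite hornerZ hornerXn -/u -(signr_odd _ k.+2) /= negbK signr_odd mulrAC.
set l := (log_poly N).[u] in hl.
have lr : abs l <= abs u.
  have := @abs_horner_le r r (log_poly N) 1 u.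
  rewrite expr1 mulrC divfK ?gt_eqF //; apply => //; first exact: ltW.
    exact: gauss_log_poly.
  case=> // _; have [L ->] := log_polyX N.
  by rewrite coefXM.
have h1 : abs (plog q - l) <= (abs u / r) ^+ N.
  rewrite hl abs_distC; apply: le_trans (plog_approx qr (ltn0Sn N)) _.
  rewrite abs_distC -/u exprS mulrA (mulrC r) divfK ?gt_eqF //.
  by rewrite ler_piMl ?exprn_ge0 // (le_trans (ltW ur)) ?exp_radius_le1.
have h1' : abs (plog q - l) <= abs u.
  apply: absB_le => //; apply: le_trans (abs_plog_le qr) _.
  by rewrite abs_distC.
have -> : pexp (plog q) - q = (pexp (plog q) - pexp l) +
   (- ((\sum_(0 <= k < N.+1) l ^+ k / k`!%:R) - pexp l) +
   ((\sum_(0 <= k < N.+1) l ^+ k / k`!%:R) - q)) by ring.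
have lr' : abs l < r by exact: le_lt_trans ur.
apply: absD_le.
  (* exp(log q) - exp l = (exp(log q - l) - 1) exp l. *)
  rewrite -{1}(subrK l (plog q)) pexpD ?(le_lt_trans h1') // -{2}(mul1r (pexp l)).
  rewrite -mulrBl Cp_absM; apply: le_trans (ler_piMr _ (abs_pexp_le1 lr')) _ => //.
  by apply: le_trans (abs_pexpB1 _) h1; apply: le_lt_trans ur.
apply: absD_le.
  rewrite absN; apply: le_trans (pexp_approx _ lr') _.
  rewrite exprS; apply: le_trans (ler_piMl _ _) _;
    rewrite ?exprn_ge0 ?divr_ge0 // ?(ltW exp_radius_gt0) //.
    by rewrite ltW //; case/andP: (exp_ratio lr').
  by rewrite lerXn2r ?nnegrE ?divr_ge0 ?(ltW exp_radius_gt0) // ler_wpM2r // invr_ge0 ltW.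
have -> : \sum_(0 <= k < N.+1) l ^+ k / k`!%:R = (explog_poly N).[u].
  rewrite horner_sum; apply: eq_bigr => k _.
  by rewrite hornerZ horner_exp mulrC.
have -> : q = (1 + 'X : {poly K}).[u].
  by rewrite hornerD hornerC hornerX /u addrC subrK.
rewrite -hornerN -hornerD -[leRHS]mul1r; apply: abs_horner_le => //.
- exact: ltW.
- apply: gauss_leB => //; first exact: gauss_explog_poly.
  move=> d; rewrite coefD coef1 coefX.
  case: d => [|[|d]] /=; rewrite ?addr0 ?add0r ?abs1 ?abs0 ?mul1r ?mul0r ?expr0 //.
  by rewrite expr1 exp_radius_le1.
- by move=> d dN; rewrite coefB coef_explog_poly ?subrr // ltnW.
Qed.

(** * Powers of q on the disc *)

Lemma abs_mul_lt (a z : K) c : abs a <= 1 -> abs z < c -> abs (a * z) < c.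
Proof. by move=> a1; apply: le_lt_trans; rewrite Cp_absM ler_piMl. Qed.

Lemma pexp0 : pexp (0 : K) = 1.
Proof.
apply/eqP; rewrite -subr_eq0 -[_ == 0]negbK -abs_gt0 -leNgt.
by rewrite -[leRHS](abs0) abs_pexpB1 // abs0.
Qed.

Lemma pexp_nat (z : K) n : abs z < r -> pexp (n%:R * z) = pexp z ^+ n.
Proof.
move=> zr; elim: n => [|n IH]; first by rewrite mul0r pexp0.
by rewrite -natr1 mulrDl mul1r pexpD ?IH ?exprSr ?abs_mul_lt ?abs_nat_le1.
Qed.

Lemma pexp_inj (a b : K) : abs a < r -> abs b < r -> pexp a = pexp b -> a = b.
Proof.
move=> ar br ab; have Nbr : abs (- b) < r by rewrite absN.
apply/eqP; rewrite -subr_eq0; apply/eqP/pexp_eq1; first exact: absD_lt.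
by rewrite pexpD // ab -pexpD // subrr pexp0.
Qed.

Section Disc.
Variable q : K.
Hypothesis q_near1 : abs (1 - q) < r.

Lemma abs_plog_lt : abs (plog q) < r.
Proof. exact: le_lt_trans (abs_plog_le _) _. Qed.

Lemma abs_natM_plog_lt n : abs (n%:R * plog q) < r.
Proof. by rewrite abs_mul_lt ?abs_nat_le1 ?abs_plog_lt. Qed.

Lemma ppow_nat n : ppow q n%:R = q ^+ n.
Proof. by rewrite /ppow pexp_nat ?abs_plog_lt // pexp_plog. Qed.

Lemma qnum_nat n : qnum q n%:R = (1 - q ^+ n) / (1 - q).
Proof. by rewrite /qnum ppow_nat. Qed.

Lemma ppow_addn (a : K) n : abs (a * plog q) < r ->
  ppow q (a + n%:R) = ppow q a * q ^+ n.
Proof.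
by move=> ar; rewrite -ppow_nat /ppow mulrDl pexpD ?abs_natM_plog_lt.
Qed.

(** At n = p^N this makes q^n tend to 1 like p^(-N), the convergence rate of the Riemann sums. *)
Lemma abs_expn_sub1_le n : abs (q ^+ n - 1) <= abs n%:R.
Proof.
rewrite -ppow_nat; apply: le_trans (abs_pexpB1 (abs_natM_plog_lt n)) _.
by rewrite Cp_absM ler_piMr // ltW // (lt_trans abs_plog_lt) ?exp_radius_lt1.
Qed.

Lemma disc_expn n : abs (1 - q ^+ n) < r.
Proof.
rewrite abs_distC -ppow_nat; apply: le_lt_trans (abs_pexpB1 (abs_natM_plog_lt n)) _.
exact: abs_natM_plog_lt.
Qed.

(** Both sides have exponential q^n; injectivity of exp replaces a functional equation for log. *)
Lemma plog_expn n : plog (q ^+ n) = n%:R * plog q.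
Proof.
apply: pexp_inj; rewrite ?abs_natM_plog_lt //.
  exact: le_lt_trans (abs_plog_le (disc_expn n)) (disc_expn n).
by rewrite pexp_plog ?disc_expn // -ppow_nat.
Qed.

(** If q^n = 1 then n log q = 0, so log q = 0 and q = exp 0 = 1. All denominators below are nonzero
    for this reason. *)
Lemma expn_neq1 n : q <> 1 -> (0 < n)%N -> 1 - q ^+ n != 0.
Proof.
move=> q1 n0; apply/negP; rewrite subr_eq0 => /eqP/esym/(congr1 (@plog p R K)).
rewrite plog_expn -[1](expr0 q) plog_expn mul0r => /eqP.
rewrite mulf_eq0 (negPf (natr_neq0 n0)) => /eqP l0.
by apply: q1; rewrite -(pexp_plog q_near1) l0 pexp0.
Qed.

End Disc.

(** * The integral of a polynomial in Q^y *)

Lemma horner_lipschitz1 (H : {poly K}) : exists2 C, 0 <= C &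
  forall t, abs t <= 1 -> abs (H.[t] - H.[1]) <= C * abs (t - 1).
Proof.
have : root (H - H.[1]%:P) 1 by rewrite rootE hornerD hornerN hornerC subrr.
case/factor_theorem => G HG; pose C := \sum_(i < size G) abs G`_i.
have C0 : 0 <= C by apply: sumr_ge0.
exists C => // t t1.
have -> : H.[t] - H.[1] = G.[t] * (t - 1).
  have := congr1 (fun P : {poly K} => P.[t]) HG.
  by rewrite hornerM hornerXsubC hornerD hornerN hornerC.
rewrite Cp_absM ler_wpM2r // horner_coef; apply: abs_sum_le => // i _.
rewrite Cp_absM absX; apply: le_trans (ler_piMr _ _) _; rewrite ?exprn_ile1 //.
by rewrite /C (bigD1 i) //= lerDl sumr_ge0.
Qed.

(* The Riemann sums of a polynomial in Q^y are geometric sums: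
   sum_(y < L) Q^((i+1)y) / [L]_Q = (1-Q) / (1-Q^(i+1)) * sum_(j <= i) Q^(Lj). *)
Lemma qintegral_poly (Q : K) (f : K -> K) (c : nat -> K) M :
  abs (1 - Q) < r -> Q <> 1 ->
  (forall y : nat, f y%:R = \sum_(i < M) c i * (Q ^+ y) ^+ i) ->
  qintegral Q f = \sum_(i < M) c i * ((1 - Q) * i.+1%:R / (1 - Q ^+ i.+1)).
Proof.
move=> Qr Q1 hf.
(* The N-th Riemann sum is [H] at Q^(p^N), so the limit is [H] at 1, where the inner sum becomes
   i+1. *)
pose H : {poly K} :=
  \sum_(i < M) (c i * ((1 - Q) / (1 - Q ^+ i.+1))) *: \sum_(j < i.+1) 'X^j.
have Q10 : 1 - Q != 0 by rewrite subr_eq0 eq_sym; apply/eqP.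
have Ht t : H.[t] =
    \sum_(i < M) c i * ((1 - Q) / (1 - Q ^+ i.+1)) * \sum_(j < i.+1) t ^+ j.
  rewrite horner_sum; apply: eq_bigr => i _; rewrite hornerZ horner_sum.
  by congr (_ * _); apply: eq_bigr => j _; rewrite hornerXn.
have -> : \sum_(i < M) c i * ((1 - Q) * i.+1%:R / (1 - Q ^+ i.+1)) = H.[1].
  rewrite Ht; apply: eq_bigr => i _.
  rewrite (eq_bigr (fun=> 1)) => [|j _]; last by rewrite expr1n.
  by rewrite sumr_const card_ord mulrAC !mulrA.
have [C C0 hC] := horner_lipschitz1 H.
apply: plimE; apply: (@cvg_abs_geometric _ _ 0 C p%:R^-1).
  by rewrite invr_ge0 ler0n invf_lt1 ?ltr0n ?ltr1n ?prime_gt1 ?prime_gt0.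
move=> N _; set L := (p ^ N)%N.
have L0 : (0 < L)%N by rewrite expn_gt0 prime_gt0.
have QL := expn_neq1 Qr Q1 L0.
have -> : (qnum Q L%:R)^-1 * (\sum_(0 <= y < L) f y%:R * Q ^+ y) = H.[Q ^+ L].
  rewrite qnum_nat // Ht big_mkord.
  rewrite (eq_bigr (fun y : 'I_L => \sum_(i < M) c i * (Q ^+ i.+1) ^+ y)); last first.
    move=> y _; rewrite hf mulr_suml; apply: eq_bigr => i _.
    by rewrite -mulrA -exprSr -!exprM mulnC.
  rewrite exchange_big mulr_sumr; apply: eq_bigr => i _ /=.
  rewrite -mulr_sumr.
  have Qi := expn_neq1 Qr Q1 (ltn0Sn i).
  (* Both sides equal 1 - Q^((i+1)L). *)
  have /(canRL (mulKf Qi)) -> :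
      (1 - Q ^+ i.+1) * (\sum_(y < L) (Q ^+ i.+1) ^+ y) =
      (1 - Q ^+ L) * \sum_(j < i.+1) (Q ^+ L) ^+ j.
    by rewrite -[1 - Q ^+ _]opprB mulNr -subrX1 -[1 - Q ^+ L]opprB mulNr -subrX1
      -!exprM mulnC.
  move: (1 - Q ^+ L) (1 - Q ^+ i.+1) (1 - Q) (\sum_(j < _) _) QL Qi Q10.
  by move=> A B D S A0 B0 D0; field; rewrite A0 B0 D0.
have QLle := abs_expn_sub1_le Qr L.
have QL1 : abs (Q ^+ L) <= 1.
  rewrite -(subrK 1 (Q ^+ L)); apply: absD_le; last by rewrite abs1.
  exact: le_trans QLle (abs_nat_le1 _).
apply: le_trans (hC _ QL1) _; rewrite ler_wpM2l //; apply: le_trans QLle _.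
by rewrite natrX absX Cp_absp.
Qed.

(** * Explicit degenerate q-Bernoulli polynomials *)

Definition qnum_binom_poly (lam q : K) m : {poly K} :=
  \prod_(i < m) ((1 - q)^-1 *: (1 - 'X) - (lam * i%:R)%:P).

(** Take c = [W]_q and T = q^(Wz): then [z]_(q^W) = [Wz]_q / c, and dividing by nu = lam / c cancels
    c, so that only nu^m leaves a power of c. [qnum_binom_poly] is the falling factorial of (1 -
    T)/(1 - q) with step [lam]. *)
Lemma degen_pow_coef_scale (lam c q T : K) m : lam != 0 -> c != 0 ->
  degen_pow_coef (lam / c) ((1 - T) / (1 - q) / c) m =
  (c ^+ m * m`!%:R)^-1 * (qnum_binom_poly lam q m).[T].
Proof.
move=> lam0 c0; rewrite /degen_pow_coef /gbinom mulrAC horner_prod.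
have -> : (lam / c) ^+ m = \prod_(i < m) (lam / c) by rewrite prodr_const card_ord.
rewrite -big_split /= (eq_bigr (fun i : 'I_m => c^-1 *
    ((1 - q)^-1 *: (1 - 'X) - (lam * i%:R)%:P).[T])) => [|i _]; last first.
  rewrite !hornerE; set z := (1 - q)^-1.
  rewrite -[LHS]/(((1 - T) * z / c / (lam / c) - i%:R) * lam / c).
  by field; rewrite c0 lam0.
by rewrite big_split /= prodr_const card_ord exprVn invfM mulrAC.
Qed.

(** The smallness condition is on W a log q, not on a: the arguments to come have denominators w_j
    that p may divide, and W clears them. *)
Lemma degen_qbernoulliE (q lam a : K) (W m : nat) :
  abs (1 - q) < r -> q <> 1 -> lam != 0 -> (0 < W)%N ->
  abs (a * (W%:R * plog q)) < r ->
  let G := qnum_binom_poly lam q m in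
  degen_qbernoulli m (lam / qnum q W%:R) (q ^+ W) a =
  (qnum q W%:R ^+ m)^-1 * \sum_(i < size G) G`_i *
    pexp (a * (W%:R * plog q)) ^+ i *
    ((1 - q ^+ W) * i.+1%:R / (1 - (q ^+ W) ^+ i.+1)).
Proof.
move=> qr q1 lam0 W0 ar G; set A := pexp _.
have Qr := disc_expn qr W; have Q10 := expn_neq1 qr q1 W0.
have Q1 : q ^+ W <> 1 by move=> e; rewrite e subrr eqxx in Q10.
have q10 : 1 - q != 0 by rewrite subr_eq0 eq_sym; apply/eqP.
have w0 : qnum q W%:R != 0 by rewrite qnum_nat // mulf_neq0 ?invr_eq0.
rewrite /degen_qbernoulli (@qintegral_poly _ _
  (fun i => (qnum q W%:R ^+ m * m`!%:R)^-1 * (G`_i * A ^+ i)) (size G)) //.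
  rewrite !mulr_sumr; apply: eq_bigr => i _.
  move: (expf_neq0 m w0) (fact_neq0 m).
  move: (qnum _ _ ^+ m) (m`!%:R) (_ / _) (A ^+ i) => u v z B u0 v0.
  by field; rewrite u0 v0.
(* Q^(a+y) = A Q^y, and 1 - Q = (1 - q) [W]_q. *)
move=> y; have -> : qnum (q ^+ W) (a + y%:R) =
    (1 - A * (q ^+ W) ^+ y) / (1 - q) / qnum q W%:R.
  rewrite /qnum ppow_addn ?plog_expn // -/(qnum _ _) qnum_nat //.
  rewrite /ppow plog_expn // -/A; field; rewrite q10 //.
rewrite degen_pow_coef_scale // horner_coef mulr_sumr; apply: eq_bigr => i _.
by rewrite (exprMn i A) -!mulrA.
Qed.
End PadicAbs.

(** * The sum over the box, and the symmetric closed form *)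

(** The range of k_j depends on j, so the distributive law is transported from functions into the
    tagged union of the ranges. *)
Lemma bigA_distr_dffun (F : comRingType) (I : finType) (T_ : I -> finType)
    (f : forall i, T_ i -> F) :
  \prod_i \sum_(x : T_ i) f i x = \sum_(k : {dffun forall i, T_ i}) \prod_i f i (k i).
Proof.
rewrite (reindex (@dffun_of_fprod I T_)); last exact/onW_bij/dffun_of_fprod_bij.
transitivity (\sum_(t : fprod T_) \prod_(i in I) [ffun x => f i x] (t i)).
  rewrite big_fprod.
  transitivity (\prod_i \sum_(u in tagged_with T_ i)
      untag 0 [ffun x : T_ i => f i x] u).
    apply: eq_bigr => i _; rewrite -(big_tag (fun j x => [ffun x0 : T_ j => f j x0] x)).
    by apply: eq_bigr => x _; rewrite ffunE.
  exact: (bigA_distr_big_dep (fun i => mem (tagged_with T_ i))).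
by apply: eq_bigr => t _; apply: eq_bigr => i _; rewrite !ffunE.
Qed.

Lemma prod_winit_wlast n (w : 'I_n.+1 -> nat) (s : 'S_n.+1) :
  (\prod_i w i = Wprod w s * wlast w s)%N.
Proof. by rewrite (reindex_inj (@perm_inj _ s)) big_ord_recr. Qed.

Lemma Wprod_rem n (w : 'I_n.+1 -> nat) (s : 'S_n.+1) (j : 'I_n) :
  (Wprod w s = winit w s j * \prod_(i < n | i != j) winit w s i)%N.
Proof. by rewrite /Wprod (bigD1 j). Qed.

(** The exponent is the sum of (P/w_j) k_j, so the sum factors into the quotients (1 - z^P)/(1 -
    z^(P/w_j)) over all weights but the last. As P divided by the last weight is W, the factor 1 -
    z^W completes the denominator to a product over all weights. There are n+1 weights, hence the
    exponent [n]. *)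
Lemma box_geometric_sum (F : fieldType) n (w : 'I_n.+1 -> nat) (s : 'S_n.+1) (z : F) :
  (forall i, (0 < w i)%N) -> (forall k, (0 < k)%N -> 1 - z ^+ k != 0) ->
  (\sum_(k : {dffun forall j : 'I_n, 'I_(winit w s j)})
     z ^+ (wlast w s * \sum_(j < n) (\prod_(i < n | i != j) winit w s i) * k j)%N)
    / (1 - z ^+ Wprod w s) =
  (1 - z ^+ (\prod_i w i)%N) ^+ n / \prod_i (1 - z ^+ (\prod_i w i %/ w i)%N).
Proof.
move=> w0 z1; set P := (\prod_i w i)%N.
have PE : P = (Wprod w s * wlast w s)%N := prod_winit_wlast w s.
have P0 : (0 < P)%N by rewrite prodn_gt0.
have divP i : (w i %| P)%N by rewrite /P (bigD1 i) //= dvdn_mulr.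
have Pj j : (P %/ winit w s j = wlast w s * \prod_(i < n | i != j) winit w s i)%N.
  by rewrite PE (Wprod_rem w s j) -mulnA mulKn ?w0 // mulnC.
have den0 i : 1 - z ^+ (P %/ w i) != 0.
  by rewrite z1 // divn_gt0 // dvdn_leq.
rewrite [in RHS](reindex_inj (@perm_inj _ s)) big_ord_recr /= -/(wlast w s).
have -> : (P %/ wlast w s = Wprod w s)%N by rewrite PE mulnK ?w0.
rewrite invfM mulrA; congr (_ / _).
transitivity (\prod_(j < n) ((1 - z ^+ P) / (1 - z ^+ (P %/ winit w s j)))); last first.
  by rewrite prodf_div prodr_const card_ord.
transitivity (\prod_(j < n) \sum_(x < winit w s j) (z ^+ (P %/ winit w s j)) ^+ x).
  rewrite bigA_distr_dffun; apply: eq_bigr => k _.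
  rewrite big_distrr /= expr_sum; apply: eq_bigr => j _.
  by rewrite Pj -exprM mulnA.
apply: eq_bigr => j _; set y := z ^+ (P %/ _).
have -> : z ^+ P = y ^+ winit w s j by rewrite -exprM divnK ?divP.
apply: (mulfI (den0 (s (widen_ord (leqnSn n) j)))).
rewrite -/(winit w s j) -/y mulrCA divff ?den0 // mulr1.
by rewrite -[1 - y]opprB mulNr -subrX1 opprB.
Qed.

Lemma symm_exprE (p : nat) (R : realType) (K : padicComplex p R) (q lam x : K)
    (n : nat) (w : 'I_n.+1 -> nat) (m : nat) (s : 'S_n.+1) :
  prime p -> q <> 1 -> Cp_abs (1 - q) < exp_radius p R -> lam != 0 ->
  (forall i, (0 < w i)%N) -> Cp_abs x <= 1 ->
  let P := (\prod_i w i)%N in let G := qnum_binom_poly lam q m in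
  symm_expr w s m q lam x =
  (1 - q) * \sum_(i < size G) G`_i * pexp (P%:R * x * plog q) ^+ i * i.+1%:R *
    ((1 - (q ^+ i.+1) ^+ P) ^+ n / \prod_j (1 - (q ^+ i.+1) ^+ (P %/ w j))).
Proof.
move=> p_pr q1 qr lam0 w0 x1 P G; rewrite /symm_expr.
have W0 : (0 < Wprod w s)%N by rewrite prodn_gt0 // => j; exact: w0.
set W := Wprod w s in W0 *; set A0 := pexp _.
pose e (k : {dffun forall j : 'I_n, 'I_(winit w s j)}) :=
  (wlast w s * \sum_(j < n) (\prod_(i < n | i != j) winit w s i) * k j)%N.
have PE : P = (W * wlast w s)%N := prod_winit_wlast w s.
have W1 := expn_neq1 p_pr qr q1 W0.
have q10 : 1 - q != 0 by rewrite subr_eq0 eq_sym; apply/eqP.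
(* Multiplying by W clears the denominators and splits the argument into Px, free of [s], and the
   integer [e k]. *)
have arg (k : {dffun forall j : 'I_n, 'I_(winit w s j)}) :
    ((wlast w s)%:R * x + \sum_(j < n) (wlast w s)%:R / (winit w s j)%:R * (k j)%:R)
      * (W%:R * plog q) = P%:R * x * plog q + (e k)%:R * plog q.
  rewrite mulrA -mulrDl; congr (_ * _).
  rewrite mulrDl mulr_suml /e big_distrr /= natr_sum PE natrM; congr (_ + _).
    by rewrite mulrAC (mulrC (wlast w s)%:R).
  apply: eq_bigr => j _; rewrite /W (Wprod_rem w s j) !natrM.
  have := natr_neq0 K p_pr (w0 (s (widen_ord (leqnSn n) j))); rewrite -/(winit w s j).
  by move=> wj; field.
have Px : Cp_abs (P%:R * x * plog q) < exp_radius p R.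
  by rewrite -mulrA !abs_mul_lt ?abs_nat_le1 ?abs_plog_lt.
have betaE (k : {dffun forall j : 'I_n, 'I_(winit w s j)}) :
    degen_qbernoulli m (lam / qnum q W%:R) (q ^+ W)
    ((wlast w s)%:R * x + \sum_(j < n) (wlast w s)%:R / (winit w s j)%:R * (k j)%:R) =
    (qnum q W%:R ^+ m)^-1 * \sum_(i < size G) G`_i * (A0 * q ^+ e k) ^+ i *
      ((1 - q ^+ W) * i.+1%:R / (1 - (q ^+ W) ^+ i.+1)).
  have ek := abs_natM_plog_lt p_pr qr (e k).
  rewrite degen_qbernoulliE // arg; last exact: absD_lt.
  by rewrite pexpD // -/A0 pexp_nat ?abs_plog_lt // pexp_plog.
under eq_bigr => k _ do rewrite betaE mulrCA.
rewrite -mulr_sumr mulrA.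
have w1 : qnum q W%:R != 0 by rewrite qnum_nat // mulf_neq0 ?invr_eq0.
(* What remains is 1/[W]_q; its denominator 1 - q^W cancels against the numerator in the
   integral. *)
have -> : qnum q W%:R ^ (m%:Z - 1) / qnum q W%:R ^+ m = (1 - q) / (1 - q ^+ W).
  rewrite expfzDr // -exprnP mulrAC divff ?expf_neq0 // mul1r exprN1.
  by rewrite qnum_nat // invf_div.
under eq_bigr => k _ do rewrite mulr_sumr.
rewrite exchange_big !mulr_sumr; apply: eq_bigr => i _ /=.
have zn k : (0 < k)%N -> 1 - (q ^+ i.+1) ^+ k != 0.
  by move=> k0; rewrite -exprM expn_neq1 // muln_gt0.
rewrite -(box_geometric_sum s w0 zn).
rewrite -/W (exprAC _ _ W) !mulr_suml !mulr_sumr; apply: eq_bigr => k _.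
have W2 : 1 - (q ^+ W) ^+ i.+1 != 0 by rewrite -exprM expn_neq1 // muln_gt0 W0.
(* The weight q^(e k) joins the i-th power coming from [G], giving the exponent i+1 that matches z =
   q^(i+1). *)
rewrite -/(e k) (exprMn i A0) (exprAC _ _ (e k)) (exprS (q ^+ e k)).
move: (q ^+ e k) ((q ^+ W) ^+ i.+1) (q ^+ W) (1 - q) W1 W2 => a b c d W1 W2.
by field; rewrite W1 W2.
Qed.

Unset Implicit Arguments.

Theorem theorem2p2 (p : nat) (R : realType) (K : padicComplex p R)
  (p_prime : prime p) (p_odd : odd p)
  (q : K) (q_neq1 : q <> 1) (q_near1 : Cp_abs (1 - q) < exp_radius p R)
  (lam : K) (lam_neq0 : lam <> 0) (lam_le1 : Cp_abs lam <= 1)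
  (n : nat) (w : 'I_n.+1 -> nat) (w_gt0 : forall i, (0 < w i)%N)
  (m : nat) (x : K) (x_Zp : padic_int x) (s t : 'S_n.+1) :
  symm_expr w s m q lam x = symm_expr w t m q lam x.
Proof.
have lam0 : lam != 0 by exact/eqP.
by case: x_Zp => _ x1; rewrite !symm_exprE.
Qed.
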